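(* Let $\alpha\in(0,2)$, $h>0$, $\gamma>0$, let $J\ge1$ be an integer and $K\ge2J$ an odd integer, and let $L=Jh$. Assume $h+I_\alpha^L\neq0$. Let $L_\alpha^{h,J,K}=\Gamma_\alpha^{h,J,K}+\Lambda_\alpha^{h,J,K}$ be the truncated discrete fractional Fokker–Planck operator acting on vectors $(f_j)_{-J\le j\le J}$, as defined in the context. Then: (i) It preserves the equilibrium: $(L_\alpha^{h,J,K}M)_j=0$ for all $j\in\{-J,\dots,J\}$, where $M=(M_j)_{-J\le j\le J}$. (ii) It preserves the total mass: if $\Delta t>0$ and $\frac{f^{n+1}-f^n}{\Delta t}=L_\alpha^{h,J,K}f^{n+1}$, then $$\sum_{j=-J}^Jf_j^{n+1}h+I_\alpha^L\,(f_J^{n+1}+f_{-J}^{n+1})=\sum_{j=-J}^Jf_j^{n}h+I_\alpha^L\,(f_J^{n}+f_{-J}^{n}).$$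
   Context: Equilibrium: $\mu_\alpha(v)=\frac{1}{2\pi}\int_{\mathbb{R}}\exp(iv\xi-|\xi|^\alpha/\alpha)\,d\xi$, $M_j=\mu_\alpha(jh)>0$. Weights: $C_{1,\alpha}=\frac{2^\alpha\Gamma((\alpha+1)/2)}{\pi^{1/2}|\Gamma(-\alpha/2)|}$; $\varphi_\alpha(t)=\frac{t^{2-\alpha}}{(2-\alpha)(\alpha-1)\alpha}$ if $\alpha\ne1$, $\varphi_1(t)=t-t\ln t$. For $|k|<K$: $\beta^h_1=\frac{C_{1,\alpha}}{h^{1+\alpha}}\big[\frac1{2-\alpha}-\varphi_\alpha''(1)-\frac{\varphi_\alpha'(3)+3\varphi_\alpha'(1)}2+\varphi_\alpha(3)-\varphi_\alpha(1)\big]$; $\beta^h_k=\frac{2C_{1,\alpha}}{h^{1+\alpha}}\big[\varphi_\alpha'(k+1)+\varphi_\alpha'(k-1)-\varphi_\alpha(k+1)+\varphi_\alpha(k-1)\big]$ for even $k\ge2$; $\beta^h_k=\frac{C_{1,\alpha}}{h^{1+\alpha}}\big[-\frac{\varphi_\alpha'(k+2)+6\varphi_\alpha'(k)+\varphi_\alpha'(k-2)}2+\varphi_\alpha(k+2)-\varphi_\alpha(k-2)\big]$ for odd $k\ge3$; $\beta^h_{-k}=\beta^h_k$; $\beta_0^h$ is an arbitrary fixed real number. For $k=\pm K$: $\beta^h_{\pm K}=\frac{C_{1,\alpha}}{2h^{1+\alpha}}\big(2\varphi_\alpha''(K)+2\varphi_\alpha(K)-2\varphi_\alpha(K-2)-\varphi_\alpha'(K-2)-3\varphi_\alpha'(K)\big)$.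 Truncated fractional Laplacian (a matrix indexed by $j,k\in\{-J,\dots,J\}$): $\Lambda_\alpha^{h,J,K}=-\Big(\frac{2C_{1,\alpha}}{\alpha(Kh)^\alpha}+\sum_{k=-K}^K\beta_k^hh\Big)I+P+Q$, where $P_{jk}=h\beta^h_{j-k}$ if $|k|<J$, $P_{j,J}=h\sum_{l=J}^{j+K}\beta^h_{j-l}(J/l)^\gamma$, $P_{j,-J}=h\sum_{l=j-K}^{-J}\beta^h_{j-l}(J/|l|)^\gamma$; $Q_{jk}=0$ if $|k|<J$, $Q_{j,\pm J}=\frac{C_{1,\alpha}(Jh)^\gamma}{(Kh)^{\alpha+\gamma}(\alpha+\gamma)}\,{}_2F_1\big(\gamma,\alpha+\gamma;1+\alpha+\gamma;\mp\frac jK\big)$, with ${}_2F_1$ the Gauss hypergeometric function. Tail parameter: $I_\alpha^L=\frac{1}{2M_J}\Big(1-\sum_{j=-J}^JM_jh\Big)$. Drift: for $0\le j\le J-1$, $(VM)_{j+1/2}=-(VM)_{-j-1/2}:=-\frac12\sum_{k=-j}^j(\Lambda_\alpha^{h,J,K}M)_k\,h$. Set $A_{j+1/2}(f)=\frac12(VM)_{j+1/2}\big(\frac{f_{j+1}}{M_{j+1}}+\frac{f_j}{M_j}\big)$ for $-J\le j\le J-1$. Then $(\Gamma_\alpha^{h,J,K}f)_j=\frac1h\big(A_{j+1/2}(f)-A_{j-1/2}(f)\big)$ for $|j|<J$, $(\Gamma_\alpha^{h,J,K}f)_J=\frac1h\big(\mathcal F_{J+1/2}(f)-A_{J-1/2}(f)\big)$,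 $(\Gamma_\alpha^{h,J,K}f)_{-J}=\frac1h\big(A_{-J+1/2}(f)-\mathcal F_{-J-1/2}(f)\big)$, where, with $\Lambda=\Lambda_\alpha^{h,J,K}$, $\mathcal F_{J+1/2}(f)=-h(\Lambda f)_J-\frac{h}{2(h+I_\alpha^L)}\sum_{k=-J+1}^{J-1}(\Lambda f)_kh+\frac{I_\alpha^L}{h+I_\alpha^L}A_{J-1/2}(f)$, $\mathcal F_{-J-1/2}(f)=h(\Lambda f)_{-J}+\frac{h}{2(h+I_\alpha^L)}\sum_{k=-J+1}^{J-1}(\Lambda f)_kh+\frac{I_\alpha^L}{h+I_\alpha^L}A_{-J+1/2}(f)$. *)

(* Defs.v *)
From HB Require Import structures.
From mathcomp Require Import all_boot all_order all_algebra.
From mathcomp Require Import all_classical all_reals all_analysis.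
From mathcomp Require Import measurable_realfun complex.
Set Implicit Arguments.
Unset Strict Implicit.
Unset Printing Implicit Defensive.
Import Order.TTheory GRing.Theory Num.Theory numFieldNormedType.Exports.
Local Open Scope complex_scope.
Local Open Scope ring_scope.

(* \sum_(k = a)^b F k over the integers, empty when b < a. *)
Definition zsum (R : realType) (a b : int) (F : int -> R) : R :=
  if a <= b then \sum_(i < (absz (b - a)%R).+1) F (a + i%:Z) else 0.

Definition cexp (R : realType) (z : R[i]) : R[i] :=
  let: x +i* y := z in (expR x * cos y) +i* (expR x * sin y).

Definition cintegral (R : realType) (f : R -> R[i]) : R[i] :=
  (\int[lebesgue_measure]_x complex.Re (f x))
    +i* (\int[lebesgue_measure]_x complex.Im (f x)).

(* Euler's integral for x > 0, continued to the negative non-integers by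
   Gamma x = Gamma (x + 1) / x; the value at the poles is junk. *)
Definition Gamma_int (R : realType) (x : R) : R :=
  \int[lebesgue_measure]_(t in `]0, +oo[) (t `^ (x - 1) * expR (- t)).

Fixpoint Gamma_shift (R : realType) (n : nat) (x : R) : R :=
  if n is m.+1 then Gamma_shift m (x + 1) / x else Gamma_int x.

Definition Gamma (R : realType) (x : R) : R :=
  if 0 < x then Gamma_int x else Gamma_shift (Num.truncn (- x)).+1 x.

Definition pochhammer (R : realType) (a : R) (n : nat) : R :=
  \prod_(i < n) (a + i%:R).

(* The Gauss series; it is only used for |z| < 1, where it converges. *)
Definition hypergeom2F1 (R : realType) (a b c z : R) : R :=
  limn (series (fun n : nat =>
    pochhammer a n * pochhammer b n / (pochhammer c n * n`!%:R) * z ^+ n)).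

Definition cmu (R : realType) (alpha v : R) : R[i] :=
  ((2 * pi)^-1)%:C *
  cintegral (fun xi : R =>
    cexp ('i * (v * xi)%:C - (`|xi| `^ alpha / alpha)%:C)).

(* [cmu] is real-valued, see [Im_cmu] below. *)
Definition mu (R : realType) (alpha v : R) : R := complex.Re (cmu alpha v).

Definition equilibrium (R : realType) (alpha h : R) (j : int) : R :=
  mu alpha (j%:~R * h).

Definition C1 (R : realType) (alpha : R) : R :=
  2 `^ alpha * Gamma ((alpha + 1) / 2)
  / (Num.sqrt pi * `|Gamma (- alpha / 2)|).

Definition phi (R : realType) (alpha t : R) : R :=
  if alpha == 1 then t - t * ln t
  else t `^ (2 - alpha) / ((2 - alpha) * (alpha - 1) * alpha).

(* Only meaningful for |k| <= K; [beta0] is the arbitrary value of the weight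
   of index 0. *)
Definition beta (R : realType) (alpha h beta0 : R) (K : nat) (k : int) : R :=
  let p : R -> R := phi alpha in
  let dp : R -> R := (p^`())%classic in
  let ddp : R -> R := (p^`(2))%classic in
  let c : R := C1 alpha / h `^ (1 + alpha) in
  let n : nat := absz k in
  let x : R := n%:R in
  if n == K then
    c / 2 * (2 * ddp x + 2 * p x - 2 * p (x - 2) - dp (x - 2) - 3 * dp x)
  else if n == 0%N then beta0
  else if n == 1%N then
    c * ((2 - alpha)^-1 - ddp 1 - (dp 3 + 3 * dp 1) / 2 + p 3 - p 1)
  else if odd n then
    c * (- ((dp (x + 2) + 6 * dp x + dp (x - 2)) / 2) + p (x + 2) - p (x - 2))
  else
    2 * c * (dp (x + 1) + dp (x - 1) - p (x + 1) + p (x - 1)).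

(* The ordinal i : 'I_(2 J + 1) stands for the integer index i - J. *)
Definition zidx (J : nat) (i : 'I_(J.*2.+1)) : int := (i : nat)%:Z - J%:Z.

(* Entry of integer index j of a vector; only used for |j| <= J. *)
Definition entry (R : realType) (J : nat) (f : 'cV[R]_(J.*2.+1)) (j : int) : R :=
  f (inord (absz (j + J%:Z)%R)) ord0.

Definition equilibrium_vec (R : realType) (alpha h : R) (J : nat) :
    'cV[R]_(J.*2.+1) :=
  \col_i equilibrium alpha h (zidx i).

Definition P_entry (R : realType) (alpha h gamma beta0 : R) (J K : nat)
    (j k : int) : R :=
  if (absz k < J)%N then h * beta alpha h beta0 K (j - k)
  else if k == J%:Z then
    h * zsum J%:Z (j + K%:Z) (fun l =>
          beta alpha h beta0 K (j - l) * (J%:R / l%:~R) `^ gamma)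
  else
    h * zsum (j - K%:Z) (- J%:Z) (fun l =>
          beta alpha h beta0 K (j - l) * (J%:R / `|l|%:~R) `^ gamma).

Definition Q_entry (R : realType) (alpha h gamma : R) (J K : nat)
    (j k : int) : R :=
  let c : R := C1 alpha * (J%:R * h) `^ gamma
    / ((K%:R * h) `^ (alpha + gamma) * (alpha + gamma)) in
  let F : R -> R := hypergeom2F1 gamma (alpha + gamma) (1 + alpha + gamma) in
  if (absz k < J)%N then 0
  else if k == J%:Z then c * F (- (j%:~R / K%:R))
  else c * F (j%:~R / K%:R).

Definition Lambda (R : realType) (alpha h gamma beta0 : R) (J K : nat) :
    'M[R]_(J.*2.+1) :=
  - (2 * C1 alpha / (alpha * (K%:R * h) `^ alpha)
     + zsum (- K%:Z) K%:Z (fun k => beta alpha h beta0 K k * h))%:M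
  + \matrix_(i, k) P_entry alpha h gamma beta0 J K (zidx i) (zidx k)
  + \matrix_(i, k) Q_entry alpha h gamma J K (zidx i) (zidx k).

Definition tail_param (R : realType) (alpha h : R) (J : nat) : R :=
  (2 * equilibrium alpha h J%:Z)^-1
  * (1 - zsum (- J%:Z) J%:Z (fun j => equilibrium alpha h j * h)).

(* Quantities living at the half-integer j + 1/2 are indexed by j; in
   particular the index -j - 1/2 is represented by -j - 1. *)
Definition VM (R : realType) (alpha h gamma beta0 : R) (J K : nat)
    (j : int) : R :=
  let LM := Lambda alpha h gamma beta0 J K *m equilibrium_vec alpha h J in
  let V (i : int) : R := - 2^-1 * zsum (- i) i (fun k => entry LM k * h) in
  if 0 <= j then V j else - V (- j - 1).

Definition A_flux (R : realType) (alpha h gamma beta0 : R) (J K : nat)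
    (f : 'cV[R]_(J.*2.+1)) (j : int) : R :=
  2^-1 * VM alpha h gamma beta0 J K j
  * (entry f (j + 1) / equilibrium alpha h (j + 1)
     + entry f j / equilibrium alpha h j).

(* Boundary fluxes at J + 1/2 and -J - 1/2. *)
Definition F_right (R : realType) (alpha h gamma beta0 : R) (J K : nat)
    (f : 'cV[R]_(J.*2.+1)) : R :=
  let Lf := Lambda alpha h gamma beta0 J K *m f in
  let I := tail_param alpha h J in
  - h * entry Lf J%:Z
  - h / (2 * (h + I)) * zsum (- J%:Z + 1) (J%:Z - 1) (fun k => entry Lf k * h)
  + I / (h + I) * A_flux alpha h gamma beta0 K f (J%:Z - 1).

Definition F_left (R : realType) (alpha h gamma beta0 : R) (J K : nat)
    (f : 'cV[R]_(J.*2.+1)) : R :=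
  let Lf := Lambda alpha h gamma beta0 J K *m f in
  let I := tail_param alpha h J in
  h * entry Lf (- J%:Z)
  + h / (2 * (h + I)) * zsum (- J%:Z + 1) (J%:Z - 1) (fun k => entry Lf k * h)
  + I / (h + I) * A_flux alpha h gamma beta0 K f (- J%:Z).

Definition drift (R : realType) (alpha h gamma beta0 : R) (J K : nat)
    (f : 'cV[R]_(J.*2.+1)) : 'cV[R]_(J.*2.+1) :=
  let A := A_flux alpha h gamma beta0 K f in
  \col_i
    let j := zidx i in
    if (absz j < J)%N then h^-1 * (A j - A (j - 1))
    else if j == J%:Z then
      h^-1 * (F_right alpha h gamma beta0 K f - A (j - 1))
    else
      h^-1 * (A j - F_left alpha h gamma beta0 K f).

Definition fokker_planck (R : realType) (alpha h gamma beta0 : R) (J K : nat)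
    (f : 'cV[R]_(J.*2.+1)) : 'cV[R]_(J.*2.+1) :=
  drift alpha h gamma beta0 K f + Lambda alpha h gamma beta0 J K *m f.

Lemma entry_zidx (R : realType) (J : nat) (f : 'cV[R]_(J.*2.+1))
  (i : 'I_(J.*2.+1)) : entry f (zidx i) = f i ord0.
Proof. by rewrite /entry /zidx subrK absz_nat inord_val. Qed.

Lemma zidx_inord (J : nat) (j : int) : (absz j <= J)%N ->
  zidx (inord (absz (j + J%:Z)%R) : 'I_(J.*2.+1)) = j.
Proof.
move=> jJ; have j0 : 0 <= j + J%:Z.
  by rewrite -lerBlDr sub0r lerNl (le_trans (ler_norm _))// normrN -abszE lez_nat.
have jle : j <= J%:Z by rewrite (le_trans (ler_norm _))// -abszE lez_nat.
rewrite /zidx inordK; first by rewrite gez0_abs// addrK.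
by rewrite ltnS -lez_nat gez0_abs// -addnn PoszD lerD2r.
Qed.

Lemma Rintegral_odd (R : realType) (f : R -> R) :
  measurable_fun setT f -> (forall x, f (- x) = - f x) ->
  \int[lebesgue_measure]_x f x = 0.
Proof.
move=> mf fN; rewrite /Rintegral integralE.
set a := (X in (X - _)%E); set b := (X in (_ - X)%E).
suff -> : a = b by case: b => //= r; rewrite subrr.
have mN : measurable_fun setT (-%R : R -> measurableTypeR R).
  exact: oppr_measurable.
transitivity (\int[pushforward lebesgue_measure
    (-%R : R -> measurableTypeR R)]_x ((EFin \o f)^\+ x))%E.
  apply: eq_measure_integral => A mA _; exact/esym/lebesgue_measureN.
rewrite ge0_integral_pushforward//; last first.
  by apply: measurable_funepos; exact/measurable_EFinP.
rewrite preimage_setT; apply: eq_integral => x _.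
by rewrite /= funeposE funenegE /= fN EFinN.
Qed.

Lemma Im_cmu (R : realType) (alpha v : R) : complex.Im (cmu alpha v) = 0.
Proof.
rewrite /cmu /cintegral /= !mul0r addr0 Rintegral_odd ?mulr0//.
  apply: measurable_funM.
    apply: measurableT_comp => //; apply: measurable_funB.
      by apply: measurable_funB => //; apply: measurable_funM => //;
        exact: mulrl_measurable.
    by apply: measurable_funM => //;
      apply: (measurableT_comp (measurable_powR _)).
  apply: (@measurableT_comp _ _ _ _ _ _ (@sin R)).
    by apply: continuous_measurable_fun; exact: continuous_sin.
  apply: measurable_funB => //.
  by apply: measurable_funD => //; apply: measurable_funM => //.
by move=> x; rewrite !mul0r !add0r !mul1r !subr0 normrN mulrN sinN mulrN.
Qed.

(* Main.v *)
(* Mass conservation (ii) is a telescoping sum: the boundary fluxes are chosen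
   so that (h + I) (F_right - F_left) cancels what the diffusion creates. For
   (i), the matrix Lambda commutes with j |-> -j and M is even, so Lambda M is
   even and the increments of VM are -h (Lambda M)_j; the flux A(M) equals VM as
   soon as M does not vanish.

   It remains to see that the symmetric stable density is positive. Writing
   |x|^a as a multiple of \int (1 - cos (e^y x)) e^(-a y) dy (the scaling of the
   Levy measure becomes a translation in y), exp (-|x|^a / a) is a limit of
   products of Gaussians with exponentials of mixtures of cosines. Having a
   nonnegative cosine transform is preserved by multiplication with such
   mixtures, since cos (u x) shifts the transform, and by dominated limits. *)
Require Import Defs.
From HB Require Import structures.
From mathcomp Require Import all_boot all_order all_algebra.
From mathcomp Require Import all_classical all_reals all_analysis.
From mathcomp Require Import measurable_realfun ring lra zify.
Set Implicit Arguments.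
Unset Strict Implicit.
Unset Printing Implicit Defensive.
Import Order.TTheory GRing.Theory Num.Theory numFieldNormedType.Exports.
Local Open Scope classical_set_scope.
Local Open Scope ring_scope.

(** * Lebesgue integration on the real line *)

Notation leb := (@lebesgue_measure _).
Notation intg f := (leb.-integrable setT (EFin \o f)).
Notation "'\I_' x f" := (Rintegral leb setT (fun x => f))
  (at level 36, x name, f at level 36).

Section lebesgue_line.
Context {R : realType}.
Implicit Types f g : R -> R.

Lemma intg_measurable f : intg f -> measurable_fun setT f.
Proof. by move=> /integrableP[/measurable_EFinP]. Qed.

Lemma eq_intg f g : f =1 g -> intg f -> intg g.
Proof. by move=> /funext ->. Qed.

Lemma le_intg f g : measurable_fun setT f -> (forall x, `|f x| <= g x) ->
  intg g -> intg f.
Proof.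
move=> mf fg; apply: le_integrable => //; first exact/measurable_EFinP.
by move=> x _; rewrite lee_fin (le_trans (fg x))// ler_norm.
Qed.

Lemma intgM_bounded (h g : R -> R) C : measurable_fun setT h ->
  (forall x, `|h x| <= C) -> intg g -> intg (fun x => h x * g x).
Proof.
move=> mh hC ig; apply: (@le_intg _ (fun x => C * `|g x|)).
- by apply: measurable_funM => //; exact: intg_measurable.
- by move=> x; rewrite normrM ler_wpM2r.
- by have := integrableZl measurableT C (integrable_norm ig).
Qed.

Lemma intgD f g : intg f -> intg g -> intg (fun x => f x + g x).
Proof. exact: integrableD. Qed.

Lemma intgZ C g : intg g -> intg (fun x => C * g x).
Proof. exact: integrableZl. Qed.

Lemma Rintegral_preserving (phi : R -> measurableTypeR R) f :
  measurable_fun setT phi ->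
  (forall A, measurable A -> leb A = pushforward leb phi A) ->
  measurable_fun setT f ->
  (intg f -> intg (f \o phi)) /\ \I_ x f (phi x) = \I_ x f x.
Proof.
move=> mphi phiE mf.
have ge0E (g : R -> \bar R) : measurable_fun setT g -> (forall x, 0 <= g x)%E ->
    (\int[leb]_x g (phi x) = \int[leb]_x g x)%E.
  move=> mg g0; transitivity (\int[pushforward leb phi]_x g x)%E.
    by rewrite ge0_integral_pushforward.
  by apply/esym; apply: eq_measure_integral => A mA _; exact: phiE.
have mfphi : measurable_fun setT (f \o phi) by exact: measurableT_comp.
split.
  move=> /integrableP[_ fi]; apply/integrableP; split; first exact/measurable_EFinP.
  rewrite [ltLHS](ge0E (fun x => `|(f x)%:E|%E))//.
  by apply: measurableT_comp => //; exact/measurable_EFinP.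
rewrite /Rintegral; congr fine.
rewrite [LHS]integralE [RHS]integralE; congr (_ - _)%E.
- rewrite -(ge0E ((EFin \o f)^\+)%E)//.
    by apply: eq_integral => x _; rewrite !funeposE.
  by apply: measurable_funepos; exact/measurable_EFinP.
- rewrite -(ge0E ((EFin \o f)^\-)%E)//.
    by apply: eq_integral => x _; rewrite !funenegE.
  by apply: measurable_funeneg; exact/measurable_EFinP.
Qed.

Lemma lebesgue_measure_shift (a : R) (A : set R) : measurable A ->
  leb A = pushforward leb (fun x : R => x + a : measurableTypeR R) A.
Proof.
have mphi : measurable_fun setT (fun x : R => x + a : measurableTypeR R).
  exact: measurable_funD.
move=> mA; rewrite /pushforward.
have := @lebesgue_measure_unique R
  (pushforward leb (fun x : R => x + a : measurableTypeR R)).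
apply => //= _ [[b c]] _ <-.
rewrite /pushforward (_ : _ @^-1` _ = `]b - a, c - a]%classic); last first.
  by apply/seteqP; split => x /=; rewrite !in_itv/= ltrBlDr lerBrDr.
rewrite !lebesgue_measure_itv/= !lte_fin ltrD2r.
by case: ifPn => // _; rewrite -!EFinB; congr EFin; ring.
Qed.

Lemma RintegralD_shift (a : R) f : measurable_fun setT f ->
  \I_ x f (x + a) = \I_ x f x.
Proof.
move=> mf; apply: (@Rintegral_preserving (fun x => x + a) f _ _ mf).2.
  exact: measurable_funD.
exact: lebesgue_measure_shift.
Qed.

Lemma intg_shift (a : R) f : intg f -> intg (fun x => f (x + a)).
Proof.
move=> fi.
apply: (@Rintegral_preserving (+%R^~ a) f _ _ (intg_measurable fi)).1 => //.
  exact: measurable_funD.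
exact: lebesgue_measure_shift.
Qed.

Lemma Rintegral_dominated (f_ : (R -> R)^nat) f g :
  (forall n, measurable_fun setT (f_ n)) ->
  (forall x, f_ ^~ x @ \oo --> f x) ->
  intg g -> (forall n x, `|f_ n x| <= g x) ->
  intg f /\ (\I_ x f_ n x) @[n --> \oo] --> \I_ x f x.
Proof.
move=> mf_ f_f ig fg.
have mf : measurable_fun setT f.
  by apply: (measurable_fun_cvg mf_) => x _; exact: f_f.
have [fi _ cvgf] : [/\ intg f,
    (\int[leb]_x `|(f_ n x)%:E - (f x)%:E|)%E @[n --> \oo] --> 0%E &
    (\int[leb]_x (f_ n x)%:E)%E @[n --> \oo] --> (\int[leb]_x (f x)%:E)%E].
  apply: dominated_convergence => //.
  - by move=> n; apply/measurable_EFinP; exact: mf_.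
  - exact/measurable_EFinP.
  - by apply: aeW => x _; apply: cvg_EFin; [exact: nearW|exact: f_f].
  - exact: ig.
  - by apply: aeW => x n _; rewrite lee_fin.
split => //; apply: fine_cvg; rewrite fineK//; exact: integrable_fin_num.
Qed.

Lemma Rintegral_gt0 f (a b c : R) : a < b -> 0 < c -> intg f ->
  (forall x, 0 <= f x) -> (forall x, a <= x <= b -> c <= f x) ->
  0 < \I_ x f x.
Proof.
move=> ab c0 fi f0 fc.
apply: (@lt_le_trans _ _ (\I_ x (c * \1_(`[a, b]%classic) x))).
  rewrite RintegralZl//; last exact: integrable_indic_itv.
  apply: mulr_gt0 => //.
  rewrite /Rintegral integral_indic// setIT.
  rewrite [X in fine X](lebesgue_measure_itv `[a, b])/=.
  by rewrite lte_fin ab/= subr_gt0.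
apply: le_Rintegral => //; first exact/intgZ/integrable_indic_itv.
move=> x _; rewrite indicE mem_setE in_itv/=.
by have [/fc|_] := boolP (a <= x <= b); rewrite ?mulr1 ?mulr0.
Qed.

Lemma Rintegral_Fubini (F : R * R -> R) (p q : R -> R) :
  measurable_fun setT F -> intg p -> intg q ->
  (forall x y, `|F (x, y)| <= p x * q y) ->
  intg (fun x => \I_ y F (x, y)) /\
  (\I_ x \I_ y F (x, y) = \I_ y \I_ x F (x, y)).
Proof.
move=> mF ip iq Fpq.
have iF : (leb \x leb)%E.-integrable setT (EFin \o F).
  apply/integrable12ltyP; first exact/measurable_EFinP.
  apply: (@le_lt_trans _ _ (\int[leb]_x ((\I_ y `|q y|)%:E * `|p x|%:E))%E).
    apply: ge0_le_integral => //.
    - by move=> x _; exact: integral_ge0.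
    - apply: (measurable_fun_fubini_tonelli_F (m2 := lebesgue_measure)
        (fun z => `|(F z)%:E|%E)) => //.
      by apply: measurableT_comp => //; exact/measurable_EFinP.
    - apply: measurable_funeM => //; apply/measurable_EFinP.
      by apply: measurableT_comp => //; exact: intg_measurable.
    - move=> x _.
      rewrite fineK; last exact/integrable_fin_num/integrable_norm.
      rewrite muleC.
      rewrite -ge0_integralZl//.
      + apply: ge0_le_integral => //.
        * apply: measurableT_comp => //; apply/measurable_EFinP.
          exact: measurableT_comp mF (measurable_pair1 x).
        * apply: measurable_funeM; apply/measurable_EFinP.
          by apply: measurableT_comp => //; exact: intg_measurable.
        * by move=> y _; rewrite lee_fin (le_trans (Fpq x y))// -normrM ler_norm.
      + apply/measurable_EFinP.
        by apply: measurableT_comp => //; exact: intg_measurable.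
  rewrite integralZl//; last exact: integrable_norm.
  rewrite ltey_eq fin_numM//; exact/integrable_fin_num/integrable_norm.
have fi12 x : (\int[leb]_y (F (x, y))%:E)%E \is a fin_num.
  apply: integrable_fin_num => //; apply: (@le_intg _ (fun y => p x * q y)).
  - exact: measurableT_comp mF (measurable_pair1 x).
  - exact: Fpq.
  - exact: intgZ.
have fi21 y : (\int[leb]_x (F (x, y))%:E)%E \is a fin_num.
  apply: integrable_fin_num => //; apply: (@le_intg _ (fun x => q y * p x)).
  - exact: measurableT_comp mF (measurable_pair2 y).
  - by move=> x; rewrite mulrC.
  - exact: intgZ.
split.
- apply: eq_integrable (integrable_fubini_F iF) => // x _ /=.
  by rewrite fineK.
- rewrite {1 3}/Rintegral; congr fine.
  under eq_integral do rewrite fineK//.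
  under [RHS]eq_integral do rewrite fineK//.
  exact: (Fubini iF).
Qed.

End lebesgue_line.

(** * Functions with a nonnegative cosine transform *)

Section positive_definite.
Context {R : realType}.
Implicit Types g k : R -> R.

Definition cosT g (v : R) : R := \I_ x (cos (v * x) * g x).

Definition posdef g := intg g /\ forall v, 0 <= cosT g v.

Lemma measurable_cosM (a : R) : measurable_fun setT (fun x => cos (a * x)).
Proof.
apply: measurableT_comp; last exact: measurable_funM.
by apply: continuous_measurable_fun; exact: continuous_cos.
Qed.

Lemma intg_cos g v : intg g -> intg (fun x => cos (v * x) * g x).
Proof.
by apply: intgM_bounded; [exact: measurable_cosM|move=> x; exact: cos_max].
Qed.

Lemma cosT_dominated (f_ : (R -> R)^nat) f g :
  (forall n, measurable_fun setT (f_ n)) ->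
  (forall x, f_ ^~ x @ \oo --> f x) ->
  intg g -> (forall n x, `|f_ n x| <= g x) ->
  intg f /\ forall v, cosT (f_ n) v @[n --> \oo] --> cosT f v.
Proof.
move=> mf_ f_f ig fg; split; first exact: (Rintegral_dominated mf_ f_f ig fg).1.
move=> v; apply: (@Rintegral_dominated _ (fun n x => cos (v * x) * f_ n x)
    (fun x => cos (v * x) * f x) g _ _ ig _).2.
- by move=> n; apply: measurable_funM => //; exact: measurable_cosM.
- by move=> x; apply: cvgMr; exact: f_f.
- by move=> n x; rewrite normrM -[leRHS]mul1r ler_pM// cos_max.
Qed.

Lemma posdef_dominated (f_ : (R -> R)^nat) f g :
  (forall n, posdef (f_ n)) -> (forall x, f_ ^~ x @ \oo --> f x) ->
  intg g -> (forall n x, `|f_ n x| <= g x) -> posdef f.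
Proof.
move=> pf_ f_f ig fg; have mf_ n := intg_measurable (pf_ n).1.
have [fi cf] := cosT_dominated mf_ f_f ig fg; split => // v.
have cv : cvgn (fun n => cosT (f_ n) v) by apply/cvg_ex; eexists; exact: cf.
rewrite -(cvg_lim _ (cf v))//; apply: limr_ge => //.
by apply: nearW => n; exact: (pf_ n).2.
Qed.

Lemma cosT_expR_ge (kap : R -> R) (B : R) g : measurable_fun setT kap ->
  (forall x, `|kap x| <= B) ->
  (forall f, posdef f -> posdef (fun x => kap x * f x)) ->
  posdef g -> forall v,
  cosT (fun x => kap x * g x) v <= cosT (fun x => expR (kap x) * g x) v.
Proof.
move=> mk kB pk pg v.
have mg := intg_measurable pg.1.
have pX i : posdef (fun x => kap x ^+ i * g x).
  elim: i => [|i IH].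
    rewrite (_ : (fun _ => _) = g)//.
    by apply/funext => x; rewrite expr0 mul1r.
  rewrite (_ : (fun _ => _) = (fun x => kap x * (kap x ^+ i * g x))).
    exact: pk.
  by apply/funext => x; rewrite exprS mulrA.
pose S n x := series (exp_coeff (kap x)) n.
have SE n x : S n.+1 x * g x = S n x * g x + n`!%:R^-1 * (kap x ^+ n * g x).
  by rewrite /S seriesSr /exp_coeff/= mulrDl; congr (_ + _); ring.
have iS n : intg (fun x => S n x * g x).
  elim: n => [|n IH].
    rewrite (_ : (fun _ => _) = (fun x => 0 * g x)); first exact: (intgZ 0 pg.1).
    by apply/funext => x; rewrite /S seriesEnat/= big_geq// mul0r.
  apply: (eq_intg (fun x => esym (SE n x))).
  apply: intgD => //; apply: intgZ; exact: (pX n).1.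
have cSE n : cosT (fun x => S n.+1 x * g x) v =
    cosT (fun x => S n x * g x) v + n`!%:R^-1 * cosT (fun x => kap x ^+ n * g x) v.
  rewrite /cosT -RintegralZl//; last exact/intg_cos/(pX n).1.
  rewrite -RintegralD//.
  - by apply: eq_Rintegral => x _; rewrite SE; ring.
  - exact: intg_cos.
  - exact/intgZ/intg_cos/(pX n).1.
have cS0 : 0 <= cosT (fun x => S 0%N x * g x) v.
  rewrite /cosT/= (_ : (fun _ => _) = cst 0); first by rewrite Rintegral_ge0.
  by apply/funext => x; rewrite /S seriesEnat/= big_geq// mul0r mulr0.
have cS n : cosT (fun x => kap x * g x) v <= cosT (fun x => S n.+2 x * g x) v.
  have fact_cosT m : 0 <= m`!%:R^-1 * cosT (fun x => kap x ^+ m * g x) v.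
    by rewrite mulr_ge0// ?(pX m).2.
  elim: n => [|n IH].
    rewrite 2!cSE (_ : 1`!%:R^-1 * _ = cosT (fun x => kap x * g x) v).
      by rewrite lerDr addr_ge0.
    by rewrite (_ : 1`! = 1)%N// invr1 mul1r.
  by rewrite cSE (le_trans IH)// lerDl.
have SB n x : `|S n x| <= expR B.
  have B0 : 0 <= B by rewrite (le_trans _ (kB x)).
  apply: (@le_trans _ _ (series (exp_coeff B) n)).
    rewrite /S !seriesEnat/= (le_trans (ler_norm_sum _ _ _))//.
    apply: ler_sum => i _; rewrite /exp_coeff/= normrM normrX.
    rewrite [`|_^-1|]ger0_norm// ler_wpM2r//.
    by rewrite lerXn2r// nnegrE.
  apply: nondecreasing_cvgn_le; last exact: is_cvg_series_exp_coeff.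
  apply/nondecreasing_seqP => i; rewrite seriesSr lerDl.
  by rewrite /exp_coeff/= divr_ge0// exprn_ge0.
have [_ /(_ v) cvS] : intg (fun x => expR (kap x) * g x) /\ forall v,
    cosT (fun x => S n x * g x) v @[n --> \oo] -->
    cosT (fun x => expR (kap x) * g x) v.
  apply: (@cosT_dominated _ _ (fun x => expR B * `|g x|)).
  - by move=> n; exact: intg_measurable.
  - by move=> x; apply: cvgMl; exact: is_cvg_series_exp_coeff.
  - exact/intgZ/(integrable_norm pg.1).
  - by move=> n x; rewrite normrM ler_wpM2r.
rewrite -(cvg_lim _ cvS)//; apply: limr_ge.
  by apply/cvg_ex; eexists; exact: cvS.
by near=> n; rewrite -(@subnK 2 n) ?addn2//; near: n; exact: nbhs_infty_ge.
Unshelve. all: by end_near. Qed.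

Lemma posdef_expR (kap : R -> R) (B : R) g : measurable_fun setT kap ->
  (forall x, `|kap x| <= B) ->
  (forall f, posdef f -> posdef (fun x => kap x * f x)) ->
  posdef g -> posdef (fun x => expR (kap x) * g x).
Proof.
move=> mk kB pk pg; split; last first.
  by move=> v; rewrite (le_trans _ (cosT_expR_ge mk kB pk pg v))// (pk _ pg).2.
apply: (@intgM_bounded _ _ _ (expR B)) pg.1.
  exact: measurableT_comp.
move=> x; rewrite ger0_norm ?expR_ge0// ler_expR.
by rewrite (le_trans _ (kB x))// ler_norm.
Qed.

Definition cosmix k (x : R) : R := \I_ y (cos (expR y * x) * k y).

Lemma measurable_cos_expRM (x : R) :
  measurable_fun setT (fun y => cos (expR y * x)).
Proof.
apply: measurableT_comp; last by apply: measurable_funM.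
by apply: continuous_measurable_fun; exact: continuous_cos.
Qed.

Lemma intg_cosmix k x : intg k -> intg (fun y => cos (expR y * x) * k y).
Proof.
apply: intgM_bounded; first exact: measurable_cos_expRM.
by move=> y; exact: cos_max.
Qed.

Lemma cosmix_le k x : intg k -> (forall y, 0 <= k y) ->
  `|cosmix k x| <= \I_ y k y.
Proof.
move=> ik k0; rewrite (le_trans (le_normr_Rintegral _ (intg_cosmix _ ik)))//.
apply: le_Rintegral => //; first exact/integrable_norm/intg_cosmix.
by move=> y _; rewrite normrM (ger0_norm (k0 y)) ler_piMl// cos_max.
Qed.

Lemma measurable_cos_expR2 :
  measurable_fun setT (fun z : R * R => cos (expR z.1 * z.2)).
Proof.
apply: measurableT_comp.
  by apply: continuous_measurable_fun; exact: continuous_cos.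
by apply: measurable_funM => //; apply: measurableT_comp.
Qed.

Lemma measurable_cosmix k : intg k -> (forall y, 0 <= k y) ->
  measurable_fun setT (cosmix k).
Proof.
move=> ik k0; have mk := intg_measurable ik.
pose F (z : R * R) := (1 + cos (expR z.1 * z.2)) * k z.1.
have mF : measurable_fun setT F.
  apply: measurable_funM; last by apply: measurableT_comp.
  by apply: measurable_funD => //; exact: measurable_cos_expR2.
rewrite (_ : cosmix k = fun x => \I_ y F (y, x) - \I_ y k y); last first.
  apply/funext => x.
  rewrite /F/= (_ : (fun y => _) = fun y => k y + cos (expR y * x) * k y).
    rewrite RintegralD//; last exact: intg_cosmix.
    by rewrite [X in X - _]addrC addrK.
  by apply/funext => y; rewrite mulrDl mul1r.
apply: measurable_funB => //; apply: measurableT_comp => //.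
apply: (measurable_fun_fubini_tonelli_G (m1 := lebesgue_measure) (EFin \o F)).
  exact/measurable_EFinP.
by move=> z; rewrite lee_fin mulr_ge0// -lerBlDl sub0r cos_geN1.
Qed.

Lemma cosT_cosmix k g v : intg k -> intg g ->
  let F y := k y * (2^-1 * (cosT g (v + expR y) + cosT g (v - expR y))) in
  intg F /\ cosT (fun x => cosmix k x * g x) v = \I_ y F y.
Proof.
move=> ik ig; have mk := intg_measurable ik; have mg := intg_measurable ig.
pose F (z : R * R) := cos (v * z.2) * (cos (expR z.1 * z.2) * k z.1 * g z.2).
have mF : measurable_fun setT F.
  apply: measurable_funM.
    by apply: (measurableT_comp (measurable_cosM v)).
  apply: measurable_funM; last by apply: measurableT_comp.
  apply: measurable_funM; last by apply: measurableT_comp.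
  exact: measurable_cos_expR2.
have Fpq y x : `|F (y, x)| <= `|k y| * `|g x|.
  rewrite /F/= !normrM -[leRHS]mul1r ler_pM ?cos_max//.
  by rewrite ler_wpM2r// ler_piMl// cos_max.
have [iF FE] := Rintegral_Fubini mF (integrable_norm ik) (integrable_norm ig) Fpq.
have F1 y : \I_ x F (y, x) =
    k y * (2^-1 * (cosT g (v + expR y) + cosT g (v - expR y))).
  rewrite /cosT -RintegralD//; [|exact: intg_cos|exact: intg_cos].
  rewrite -RintegralZl//; last by apply: intgD; exact: intg_cos.
  rewrite -RintegralZl//; last by apply: intgZ; apply: intgD; exact: intg_cos.
  apply: eq_Rintegral => x _; rewrite /F/= mulrDl mulrBl cosD cosB.
  by field.
have F2 x : \I_ y F (y, x) = cos (v * x) * (cosmix k x * g x).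
  rewrite /cosmix -RintegralZr//; last exact: intg_cosmix.
  rewrite -RintegralZl//.
  have := intgZ (g x) (intg_cosmix x ik); apply: eq_integrable => // y _ /=.
  by congr EFin; ring.
split.
  by apply: eq_integrable iF => // y _ /=; rewrite F1.
rewrite {1}/cosT; under eq_Rintegral do rewrite -F2.
by rewrite -FE; apply: eq_Rintegral => y _; rewrite F1.
Qed.

Lemma posdef_cosmix k g : intg k -> (forall y, 0 <= k y) ->
  posdef g -> posdef (fun x => cosmix k x * g x).
Proof.
move=> ik k0 [ig g0]; split.
  apply: (intgM_bounded (C := \I_ y k y)) ig; first exact: measurable_cosmix.
  by move=> x; exact: cosmix_le.
move=> v; rewrite (cosT_cosmix v ik ig).2; apply: Rintegral_ge0 => y _.
by rewrite !mulr_ge0// addr_ge0.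
Qed.

End positive_definite.

(** * Gaussians and the Levy-Khintchine formula *)

Section stable_density.
Context {R : realType}.
Implicit Types a s x y v : R.

Lemma intg_oneDsqrV : intg (fun x : R => (oneDsqr x)^-1).
Proof.
have cV : continuous (fun x : R => (oneDsqr x)^-1) by exact: continuous_oneDsqrV.
apply/integrableP; split.
  by apply/measurable_EFinP; exact: continuous_measurable_fun.
have V0 x : 0 <= (oneDsqr x)^-1 by rewrite invr_ge0.
under eq_integral do rewrite /= ger0_norm//.
rewrite ge0_symfun_integralT//; last by move=> x /=; rewrite /oneDsqr sqrrN.
rewrite (_ : [set x | _] = `[0, +oo[%classic); last first.
  by apply/seteqP; split => x/=; rewrite in_itv/= andbT.
by rewrite integral0y_oneDsqr -EFinM ltry.
Qed.

Lemma intg_expRN (phi : R -> R) (C : R) : measurable_fun setT phi ->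
  (forall x, 0 <= phi x) -> (forall x, x ^+ 2 <= C * expR (phi x)) ->
  intg (fun x => expR (- phi x)).
Proof.
move=> mphi phi0 phiC; apply: (@le_intg _ _ (fun x => (1 + C) * (oneDsqr x)^-1)).
- by apply: measurableT_comp => //; exact: measurable_funN.
- move=> x; rewrite ger0_norm ?expR_ge0// ler_pdivlMr ?oneDsqr_gt0//.
  rewrite expRN mulrC ler_pdivrMr ?expR_gt0// /oneDsqr mulrDl mul1r lerD//.
  by rewrite -expR0 ler_expR.
- exact: intgZ intg_oneDsqrV.
Qed.

Lemma intg_expRN_norm (c : R) : 0 < c -> intg (fun x : R => expR (- (c * `|x|))).
Proof.
move=> c0; apply: (@intg_expRN _ (2 / c ^+ 2)).
- by apply: measurable_funM => //; exact: measurableT_comp.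
- by move=> x; rewrite mulr_ge0// ltW.
- move=> x; have := expR_ge1Dxn 1 (mulr_ge0 (ltW c0) (normr_ge0 x)).
  rewrite exprMn real_normK ?num_real// => h.
  rewrite mulrAC ler_pdivlMr ?exprn_gt0// mulrC.
  have : 1 + c ^+ 2 * x ^+ 2 / 2 <= expR (c * `|x|) by [].
  by lra.
Qed.

Lemma intg_gaussian s : 0 < s -> intg (fun x : R => expR (- (s * x ^+ 2))).
Proof.
move=> s0; apply: (@intg_expRN _ s^-1).
- by apply: measurable_funM => //; exact: measurable_funX.
- by move=> x; rewrite mulr_ge0 ?sqr_ge0// ltW.
- move=> x; rewrite mulrC ler_pdivlMr// mulrC.
  by rewrite (le_trans _ (expR_ge1Dx _))// lerDr.
Qed.

Lemma measurable_stable a : measurable_fun setT (fun x : R => `|x| `^ a / a).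
Proof.
apply: measurable_funM => //.
by apply: (measurableT_comp (measurable_powR a)).
Qed.

Lemma intg_stable a : 0 < a -> intg (fun x : R => expR (- (`|x| `^ a / a))).
Proof.
move=> a0; pose n := (Num.truncn (2 / a)).+1.
have n2 : 2 <= a * n%:R.
  by rewrite mulrC -ler_pdivrMr// ltW// truncnS_gt.
apply: (@intg_expRN _ (1 + a ^+ n * n`!%:R)).
- exact: measurable_stable.
- by move=> x; rewrite divr_ge0 ?powR_ge0// ltW.
move=> x; have C0 : 0 <= a ^+ n * n`!%:R by rewrite mulr_ge0// exprn_ge0// ltW.
have [x1|x1] := leP `|x| 1.
  rewrite -real_normK ?num_real//.
  apply: (@le_trans _ _ 1); first by rewrite exprn_ile1.
  have : 1 <= expR (`|x| `^ a / a).
    by rewrite -expR0 ler_expR divr_ge0 ?powR_ge0// ltW.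
  by move=> h; rewrite mulrDl mul1r (le_trans h)// lerDl mulr_ge0// expR_ge0.
rewrite mulrDl mul1r -[leLHS]add0r lerD ?expR_ge0//.
have t0 : 0 <= `|x| `^ a / a by rewrite divr_ge0 ?powR_ge0// ltW.
have := expR_ge1Dxn n.-1 t0; rewrite /= => h.
apply: (@le_trans _ _ (a ^+ n * n`!%:R * ((`|x| `^ a / a) ^+ n / n`!%:R))).
  rewrite [leRHS](_ : _ = (a * (`|x| `^ a / a)) ^+ n); last first.
    rewrite [RHS]exprMn; field.
    by rewrite pnatr_eq0 -lt0n fact_gt0.
  rewrite [a * _]mulrC divfK ?gt_eqF// -[leRHS]powR_mulrn ?powR_ge0// -powRrM.
  rewrite -real_normK ?num_real// -[leLHS]powR_mulrn//.
  by rewrite ler_powR// ltW.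
by rewrite ler_wpM2l// (le_trans _ h)// lerDr.
Qed.

Lemma normr_sin_le (u : R) : `|sin u| <= `|u|.
Proof.
wlog u0 : u / 0 <= u.
  move=> h; have [/h//|/ltW u0] := leP 0 u.
  by have := h (- u); rewrite sinN !normrN oppr_ge0; exact.
have [|c _] := @MVT_segment R sin cos 0 u u0 (fun x _ => is_derive_sin x).
  by apply: continuous_subspaceT => z; exact: continuous_sin.
rewrite sin0 !subr0 => ->; by rewrite normrM ler_piMl// cos_max.
Qed.

Lemma onem_cos_le (z : R) : 1 - cos z <= z ^+ 2.
Proof.
have -> : z = (z / 2) *+ 2 by rewrite -mulr_natr divfK.
set w := z / 2; rewrite cos_mulr2n cos2sin2.
have h : sin w ^+ 2 <= w ^+ 2.
  rewrite -real_normK ?num_real// -[leRHS]real_normK ?num_real//.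
  by rewrite lerXn2r ?nnegrE// normr_sin_le.
have -> : (w *+ 2) ^+ 2 = w ^+ 2 *+ 4 by rewrite -mulr_natr exprMn -mulr_natr; ring.
by have := sqr_ge0 w; lra.
Qed.

Lemma onem_cos_ge0 (z : R) : 0 <= 1 - cos z.
Proof. by rewrite subr_ge0 cos_le1. Qed.

Lemma measurable_expRN_M a : measurable_fun setT (fun y : R => expR (- (a * y))).
Proof.
apply: measurableT_comp => //; apply: measurable_funN.
exact: measurable_funM.
Qed.

Definition levy a (x y : R) : R := (1 - cos (expR y * x)) * expR (- (a * y)).

Lemma levy_ge0 a x y : 0 <= levy a x y.
Proof. by rewrite mulr_ge0 ?onem_cos_ge0// expR_ge0. Qed.

Lemma measurable_levy a x : measurable_fun setT (levy a x).
Proof.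
apply: measurable_funM; last exact: measurable_expRN_M.
by apply: measurable_funB => //; exact: measurable_cos_expRM.
Qed.

Lemma intg_levy a x : 0 < a < 2 -> intg (levy a x).
Proof.
move=> /andP[a0 a2].
pose c := Num.min a (2 - a).
have c0 : 0 < c by rewrite lt_min a0 subr_gt0.
apply: (@le_intg _ _ (fun y => (2 + x ^+ 2) * expR (- (c * `|y|)))).
- exact: measurable_levy.
- move=> y; rewrite ger0_norm ?levy_ge0//.
  have [y0|y0] := leP 0 y.
    rewrite ger0_norm// ler_pM ?onem_cos_ge0 ?expR_ge0//.
      have := cos_geN1 (expR y * x); have := sqr_ge0 x; lra.
    by rewrite ler_expR lerN2 ler_wpM2r// ge_min lexx.
  rewrite ltr0_norm// mulrN opprK.
  apply: (@le_trans _ _ ((expR y * x) ^+ 2 * expR (- (a * y)))).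
    by rewrite ler_wpM2r ?expR_ge0// onem_cos_le.
  have -> : (expR y * x) ^+ 2 * expR (- (a * y)) = x ^+ 2 * expR (y *+ 2 - a * y).
    by rewrite exprMn mulr2n !expRD; ring.
  rewrite ler_pM ?sqr_ge0 ?expR_ge0 ?lerDr// ler_expR.
  have : c <= 2 - a by rewrite ge_min lexx orbT.
  by nra.
- exact/intgZ/intg_expRN_norm.
Qed.

Lemma levy_scale a x : 0 < a < 2 ->
  \I_ y levy a x y = `|x| `^ a * \I_ y levy a 1 y.
Proof.
move=> a02; have a0 : a != 0 by case/andP: a02 => /gt_eqF ->.
have [->|x0] := eqVneq x 0.
  rewrite normr0 powR0// mul0r /levy.
  under eq_Rintegral do rewrite mulr0 cos0 subrr mul0r.
  by rewrite Rintegral_cst// mul0r.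
have nx0 : 0 < `|x| by rewrite normr_gt0.
have levyE y : levy a x y = `|x| `^ a * levy a 1 (y + ln `|x|).
  rewrite /levy mulr1 expRD lnK//.
  have -> : cos (expR y * `|x|) = cos (expR y * x).
    by rewrite -[RHS]cos_norm normrM (ger0_norm (expR_ge0 y)).
  have -> : expR (- (a * (y + ln `|x|))) = expR (- (a * y)) / `|x| `^ a.
    by rewrite mulrDr opprD expRD /powR gt_eqF//; congr (_ * _); exact: expRN.
  by field; rewrite gt_eqF// powR_gt0.
under eq_Rintegral do rewrite levyE.
rewrite RintegralZl//; last first.
  have := intgZ (`|x| `^ a)^-1 (intg_levy x a02); apply: eq_intg => y.
  by rewrite levyE mulKf// gt_eqF// powR_gt0.
by rewrite (RintegralD_shift _ (measurable_levy a 1)).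
Qed.

Lemma levy_gt0 a : 0 < a < 2 -> 0 < \I_ y levy a 1 y.
Proof.
move=> a02; have /andP[a0 a2] := a02.
apply: (@Rintegral_gt0 _ _ (ln (pi / 2)) (ln pi) (expR (- (a * ln pi)))).
- by rewrite ltr_ln ?posrE ?divr_gt0 ?pi_gt0//; have := pi_gt0 R; lra.
- exact: expR_gt0.
- exact: intg_levy.
- exact: levy_ge0.
move=> y /andP[y1 y2]; rewrite /levy mulr1 -[leLHS]mul1r ler_pM ?expR_ge0//.
  rewrite lerBrDl -lerBrDr subrr.
  have e1 : pi / 2 <= expR y.
    by rewrite -(lnK (_ : pi / 2 \in Num.pos)) ?posrE ?divr_gt0 ?pi_gt0// ler_expR.
  have e2 : expR y <= pi.
    by rewrite -(lnK (_ : pi \in Num.pos)) ?posrE ?pi_gt0// ler_expR.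
  rewrite -(subrK pi (expR y)) cosDpi oppr_le0 cos_ge0_pihalf//.
  by apply/andP; split; lra.
by rewrite ler_expR lerN2 ler_pM2l.
Qed.

(* The Gaussian is, up to a positive factor, the autocorrelation of a Gaussian,
   so its transform is a sum of two squares. *)
Lemma posdef_gaussian s : 0 < s -> posdef (fun x : R => expR (- (s * x ^+ 2))).
Proof.
move=> s0; split; first exact: intg_gaussian.
move=> v; pose q (x : R) := expR (- (s *+ 2 * x ^+ 2)).
have iq : intg q by apply: intg_gaussian; rewrite mulrn_wgt0.
have mq := intg_measurable iq.
have mc : measurable_fun setT (fun x : R => cos (v * x)) := measurable_cosM v.
have ms : measurable_fun setT (fun x : R => sin (v * x)).
  apply: measurableT_comp; last exact: measurable_funM.
  by apply: continuous_measurable_fun; exact: continuous_sin.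
have iqs : intg (fun x => sin (v * x) * q x).
  by apply: intgM_bounded ms _ iq => x; exact: sin_max.
have iqc := intg_cos v iq.
pose D : R := \I_ x expR (- (s *+ 4 * x ^+ 2)).
have i4 : intg (fun x : R => expR (- (s *+ 4 * x ^+ 2))).
  by apply: intg_gaussian; rewrite mulrn_wgt0.
have D0 : 0 < D.
  apply: (@Rintegral_gt0 _ _ 0 1 (expR (- (s *+ 4)))) => //.
  - exact: expR_gt0.
  - move=> x /andP[x0 x1]; rewrite ler_expR lerN2; apply: ler_piMr.
      by rewrite mulrn_wge0// ltW.
    by rewrite exprn_ile1.
rewrite -(pmulr_lge0 _ D0).
pose F (z : R * R) := cos (v * z.2) * (q z.1 * q (z.1 + z.2)).
suff -> : cosT (fun x => expR (- (s * x ^+ 2))) v * D =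
    (\I_ x (cos (v * x) * q x)) ^+ 2 + (\I_ x (sin (v * x) * q x)) ^+ 2.
  by rewrite addr_ge0 ?sqr_ge0.
have qq x y : q x * q (x + y) =
    expR (- (s * y ^+ 2)) * expR (- (s *+ 4 * (x + y / 2) ^+ 2)).
  by rewrite /q -!expRD; congr expR; field.
transitivity (\I_ y \I_ x F (x, y)).
  rewrite /cosT -RintegralZr//; last exact/intg_cos/intg_gaussian.
  apply: eq_Rintegral => y _.
  under [RHS]eq_Rintegral do rewrite /F/= qq.
  have ish : intg (fun x => expR (- (s *+ 4 * (x + y / 2) ^+ 2))).
    exact: (intg_shift (y / 2) i4).
  rewrite RintegralZl//; last exact: intgZ.
  rewrite RintegralZl// mulrA; congr (_ * _).
  by rewrite (RintegralD_shift (y / 2) (intg_measurable i4)).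
have mF : measurable_fun setT F.
  apply: measurable_funM; first exact: (measurableT_comp mc).
  apply: measurable_funM; first exact: measurableT_comp.
  by apply: measurableT_comp => //; exact: measurable_funD.
have [_ <-] : intg (fun x => \I_ y F (x, y)) /\
    \I_ x \I_ y F (x, y) = \I_ y \I_ x F (x, y).
  apply: (@Rintegral_Fubini _ F (fun x => expR (- (s * x ^+ 2)))
      (fun y => expR (- (s / 3 * y ^+ 2)))) => //.
  - exact: intg_gaussian.
  - by apply: intg_gaussian; rewrite divr_gt0.
  move=> x y; rewrite normrM -[leRHS]mul1r ler_pM ?cos_max//.
  rewrite ger0_norm ?mulr_ge0 ?expR_ge0// /q -!expRD ler_expR.
  rewrite -!opprD lerN2 /= -(mulr_natr s 2).
  have := mulr_ge0 (ltW s0) (addr_ge0 (sqr_ge0 (3 * x + 2 * y)) (sqr_ge0 y)).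
  have -> : s * ((3 * x + 2 * y) ^+ 2 + y ^+ 2) =
    3 * (s * 2 * x ^+ 2 + s * 2 * (x + y) ^+ 2 - (s * x ^+ 2 + s / 3 * y ^+ 2)).
    by field.
  by rewrite pmulr_rge0// subr_ge0.
transitivity (\I_ x (q x * (cos (v * x) * (\I_ z (cos (v * z) * q z)) +
    sin (v * x) * (\I_ z (sin (v * z) * q z))))).
  apply: eq_Rintegral => x _; rewrite -!RintegralZl//; last first.
  rewrite -RintegralD//; [|exact: intgZ|exact: intgZ].
  rewrite -RintegralZl//; last by apply: intgD; exact: intgZ.
  pose H z := q x *
    (cos (v * x) * (cos (v * z) * q z) + sin (v * x) * (sin (v * z) * q z)).
  have mH : measurable_fun setT H.
    apply: intg_measurable; apply: intgZ; apply: intgD; exact: intgZ.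
  rewrite -(RintegralD_shift x mH); apply: eq_Rintegral => y _.
  rewrite /F/H/= [x + y]addrC -[y in LHS](addrK x) mulrBr cosB.
  by rewrite subrK; ring.
under eq_Rintegral do rewrite mulrDr.
rewrite RintegralD//; last first.
- have := intgZ (\I_ z (sin (v * z) * q z)) iqs; apply: eq_intg => x; ring.
- have := intgZ (\I_ z (cos (v * z) * q z)) iqc; apply: eq_intg => x; ring.
rewrite !expr2 -!RintegralZl//.
by congr (_ + _); apply: eq_Rintegral => x _; ring.
Qed.

End stable_density.

(** * Positivity of the symmetric stable density *)

Section stable_density_gt0.
Context {R : realType}.
Implicit Types a s x y v : R.

Lemma posdefZ (C : R) (g : R -> R) : 0 <= C -> posdef g ->
  posdef (fun x => C * g x).
Proof.
move=> C0 [ig g0]; split; first exact: intgZ.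
move=> v; rewrite /cosT (_ : (fun _ => _) = (fun x => C * (cos (v * x) * g x))).
  by rewrite RintegralZl ?mulr_ge0//; [exact: g0|exact: intg_cos].
by apply/funext => x; ring.
Qed.

Lemma cosT0 (g : R -> R) : cosT g 0 = \I_ x g x.
Proof. by apply: eq_Rintegral => x _; rewrite mul0r cos0 mul1r. Qed.

Lemma cosTN (g : R -> R) v : cosT g (- v) = cosT g v.
Proof. by apply: eq_Rintegral => x _; rewrite mulNr cosN. Qed.

Lemma cosT_near0 (g : R -> R) : intg g -> 0 < cosT g 0 ->
  exists2 d : R, 0 < d & forall w, `|w| < d -> cosT g 0 / 2 <= cosT g w.
Proof.
move=> ig g0.
have c0 : {for 0, continuous (cosT g)}.
  apply: (@continuity_under_integral R _ _ leb
    (fun v x => cos (v * x) * g x) setT measurableT (-1) 1 _ _ (fun x => `|g x|)).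
  - by move=> w _; exact: intg_cos.
  - apply: aeW => x _ w _; apply: cvgMl.
    apply: continuous_cvg; first exact: continuous_cos.
    by apply: cvgMl; exact: cvg_id.
  - exact: integrable_norm.
  - by move=> w _; apply: aeW => x _; rewrite normrM ler_piMl// cos_max.
  - by rewrite inE/= in_itv/=; apply/andP; split; lra.
have : \forall w \near 0, cosT g 0 / 2 < cosT g w.
  by apply: (cvgr_gt (cosT g 0) c0); lra.
move=> /nbhs_ballP[d /= d0 dh]; exists d => // w wd.
by apply/ltW/dh; rewrite /ball/= sub0r normrN.
Qed.

Variable a : R.
Hypothesis a02 : 0 < a < 2.

Let a0 : 0 < a. Proof. by case/andP: a02. Qed.

Let stable (x : R) : R := expR (- (`|x| `^ a / a)).

Let N : R := a * \I_ y levy a 1 y.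

Let N0 : 0 < N. Proof. by rewrite mulr_gt0// levy_gt0. Qed.

Let NV0 : 0 <= N^-1. Proof. by rewrite invr_ge0 ltW. Qed.

Let k (y : R) : R := N^-1 * expR (- (a * y)).

Let k0 y : 0 <= k y. Proof. by rewrite mulr_ge0 ?expR_ge0// invr_ge0 ltW. Qed.

Let mk : measurable_fun setT k.
Proof. by apply: measurable_funM => //; exact: measurable_expRN_M. Qed.

Let tail (z y : R) : R := \1_(`[z, +oo[%classic) y * k y.

Let tailE (z y : R) : tail z y = ((z <= y)%R)%:R * k y.
Proof. by rewrite /tail indicE mem_setE in_itv/= andbT. Qed.

Let tail_ge0 z y : 0 <= tail z y. Proof. by rewrite mulr_ge0. Qed.

Let intg_tail z : intg (tail z).
Proof.
apply: (@le_intg _ _ (fun y => N^-1 * expR (2 * a * `|z|) * expR (- (a * `|y|)))).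
- by apply: measurable_funM => //; exact: measurable_indic.
- move=> y; rewrite ger0_norm// tailE -mulrA -expRD.
  have [zy|_] := leP z y; last by rewrite mul0r mulr_ge0 ?expR_ge0// invr_ge0 ltW.
  rewrite mul1r /k ler_wpM2l// ler_expR.
  suff : `|y| <= 2 * `|z| + y by move: a0; nra.
  have z1 := ler_norm z; have z2 := ler_norm (- z); rewrite normrN in z2.
  have [y0|y0] := leP 0 y; first by rewrite ger0_norm//; lra.
  by rewrite ltr0_norm//; lra.
- exact/intgZ/intg_expRN_norm.
Qed.

Let cut (z : R) n (y : R) : R := \1_(`]-oo, z[%classic) y * tail (z - n%:R) y.

Let cutE (z : R) n (y : R) : cut z n y = ((z - n%:R <= y < z)%R)%:R * k y.
Proof.
rewrite /cut tailE indicE mem_setE in_itv/= mulrA -natrM; congr (_%:R * _).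
by rewrite mulnb andbC.
Qed.

Let cut_ge0 z n y : 0 <= cut z n y. Proof. by rewrite mulr_ge0. Qed.

Let intg_cut z n : intg (cut z n).
Proof.
apply: (intgM_bounded (C := 1)) (intg_tail _); first exact: measurable_indic.
by move=> y; rewrite indicE; case: (_ \in _); rewrite ?normr1// normr0.
Qed.

Let lower (z x : R) : R :=
  \I_ y (\1_(`]-oo, z[%classic) y * ((1 - cos (expR y * x)) * k y)).

Let intg_lk x : intg (fun y => (1 - cos (expR y * x)) * k y).
Proof.
have := intgZ N^-1 (intg_levy x a02); apply: eq_intg => y.
by rewrite /levy /k; ring.
Qed.

Let intg_lower z x :
  intg (fun y => \1_(`]-oo, z[%classic) y * ((1 - cos (expR y * x)) * k y)).
Proof.
apply: (intgM_bounded (C := 1)) (intg_lk _); first exact: measurable_indic.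
by move=> y; rewrite indicE; case: (_ \in _); rewrite ?normr1// normr0.
Qed.

Let onem_cosmix (q : R -> R) x : intg q ->
  cosmix q 0 - cosmix q x = \I_ y ((1 - cos (expR y * x)) * q y).
Proof.
move=> iq; rewrite /cosmix -RintegralB//; [|exact: intg_cosmix|exact: intg_cosmix].
by apply: eq_Rintegral => y _; rewrite mulr0 cos0 mulrBl.
Qed.

Let lower_tail z x :
  lower z x + (cosmix (tail z) 0 - cosmix (tail z) x) = `|x| `^ a / a.
Proof.
have it : intg (fun y => (1 - cos (expR y * x)) * tail z y).
  have := intgD (intg_lk x) (intgZ (-1) (intg_lower z x)); apply: eq_intg => y.
  rewrite tailE indicE mem_setE in_itv/=.
  by have [] := leP z y => _ /=; ring.
rewrite onem_cosmix// /lower -RintegralD//.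
transitivity (\I_ y (N^-1 * levy a x y)).
  apply: eq_Rintegral => y _; rewrite tailE indicE mem_setE in_itv/= /levy /k.
  by have [] := leP z y => _ /=; ring.
rewrite RintegralZl//; last exact: intg_levy.
rewrite levy_scale// /N; field.
by rewrite !gt_eqF ?levy_gt0.
Qed.

Let cvg_cut z x :
  cosmix (cut z n) x - cosmix (cut z n) 0 @[n --> \oo] --> - lower z x.
Proof.
under eq_cvg do rewrite -opprB onem_cosmix//.
apply: cvgN; apply: (@Rintegral_dominated _ _ _
  (fun y => (1 - cos (expR y * x)) * k y) _ _ (intg_lk x) _).2.
- move=> n; apply: measurable_funM; last exact: intg_measurable.
  by apply: measurable_funB => //; exact: measurable_cos_expRM.
- move=> y; apply: cvg_near_cst; near=> n.
  rewrite cutE indicE mem_setE in_itv/=.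
  have -> : z - n%:R <= y.
    by rewrite lerBlDr -lerBlDl; near: n; exact: nbhs_infty_ger.
  by rewrite /=; ring.
- move=> n y; rewrite cutE normrM (ger0_norm (onem_cos_ge0 _)).
  rewrite ler_wpM2l ?onem_cos_ge0// normrM (ger0_norm (k0 y)).
  by rewrite ler_piMl// ger0_norm// ?lern1 ?leq_b1.
Unshelve. all: by end_near. Qed.

Let intg_lower_stable z : intg (fun x => expR (- lower z x)).
Proof.
have B x := cosmix_le x (intg_tail z) (tail_ge0 z).
apply: (@eq_intg _ (fun x => expR (cosmix (tail z) 0 - cosmix (tail z) x) * stable x)).
  by move=> x; rewrite /stable -expRD -(lower_tail z); congr expR; ring.
apply: (intgM_bounded (C := expR (2 * \I_ y tail z y))); last exact: intg_stable.
  apply: measurableT_comp => //; apply: measurable_funB => //.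
  exact: measurable_cosmix.
move=> x; rewrite ger0_norm ?expR_ge0// ler_expR.
by have := B x; have := B 0; rewrite !ler_norml; lra.
Qed.

Let posdef_lower z : posdef (fun x => expR (- lower z x)).
Proof.
pose s n : R := n.+1%:R^-1.
have s0 n : 0 < s n by rewrite invr_gt0.
have posdef_cut m n : posdef (fun x =>
    expR (cosmix (cut z n) x - cosmix (cut z n) 0) * expR (- (s m * x ^+ 2))).
  have ic := intg_cut z n; have c0 := cut_ge0 z n.
  have := posdef_expR (measurable_cosmix ic c0) (fun x => cosmix_le x ic c0)
    (fun f => posdef_cosmix ic c0) (posdef_gaussian (s0 m)).
  move=> /(posdefZ (expR_ge0 (- cosmix (cut z n) 0))).
  by congr posdef; apply/funext => x; rewrite mulrA -expRD addrC.
have posdef_gauss m : posdef (fun x => expR (- lower z x) * expR (- (s m * x ^+ 2))).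
  apply: posdef_dominated (posdef_cut m) _ (intg_gaussian (s0 m)) _.
    move=> x; apply: cvgMl; apply: continuous_cvg; first exact: continuous_expR.
    exact: cvg_cut.
  move=> n x; rewrite ger0_norm ?mulr_ge0 ?expR_ge0// ler_piMl ?expR_ge0//.
  rewrite expR_le1 subr_le0 (le_trans (ler_norm _))//.
  rewrite (le_trans (cosmix_le _ (intg_cut z n) (cut_ge0 z n)))//.
  by apply: le_Rintegral => // [|y _]; rewrite ?mulr0 ?cos0 ?mul1r//;
    exact: intg_cosmix.
apply: posdef_dominated posdef_gauss _ (intg_lower_stable z) _.
  move=> x; rewrite -[X in _ --> X]mulr1; apply: cvgMr.
  rewrite -expR0; apply: continuous_cvg; first exact: continuous_expR.
  rewrite -oppr0; apply: cvgN; rewrite -(mul0r (x ^+ 2)); apply: cvgMl.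
  exact: cvg_harmonic.
move=> n x; rewrite ger0_norm ?mulr_ge0 ?expR_ge0// ler_piMr ?expR_ge0//.
by rewrite expR_le1 oppr_le0 mulr_ge0 ?sqr_ge0// ltW.
Qed.

(* Splitting the Levy measure at the level [z = ln v] writes the density as a
   compound Poisson smoothing of the nonnegative transform of [exp(- lower z)],
   whose single-jump term is already positive at [v]. *)
Lemma stable_density_gt0 v : 0 < cosT stable v.
Proof.
have st0 (f : R -> R) : intg f -> (forall x, stable x <= f x) -> 0 < cosT f 0.
  move=> fi sf; rewrite cosT0; apply: (@Rintegral_gt0 _ _ 0 1 (expR (- a^-1))) => //.
  - exact: expR_gt0.
  - by move=> x; rewrite (le_trans _ (sf x))// expR_ge0.
  move=> x /andP[x0 x1]; rewrite (le_trans _ (sf x))// ler_expR lerN2.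
  rewrite ler_piMl//; first by rewrite invr_ge0 ltW.
  rewrite ger0_norm//.
  rewrite [leRHS](_ : 1 = 1 `^ a :> R); last by rewrite powR1.
  by rewrite ge0_ler_powR ?nnegrE// ltW.
wlog v0 : v / 0 < v.
  move=> h; have [/h//|v0|<-] := ltgtP 0 v; last first.
    by apply: st0 => //; exact: intg_stable.
  by rewrite -cosTN h// oppr_gt0.
pose z := ln v.
have ez : expR z = v by rewrite lnK.
pose g x := expR (- lower z x).
have pg : posdef g := posdef_lower z.
have it := intg_tail z; have t0 := tail_ge0 z.
have stableE x : stable x =
    expR (- cosmix (tail z) 0) * (expR (cosmix (tail z) x) * g x).
  by rewrite /stable /g -!expRD -(lower_tail z); congr expR; ring.
have g00 : 0 < cosT g 0.
  apply: st0 pg.1 _ => x; rewrite ler_expR lerN2 -(lower_tail z) lerDl subr_ge0.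
  rewrite (le_trans (ler_norm _))// (le_trans (cosmix_le _ it t0))//.
  by apply: le_Rintegral => // [|y _]; rewrite ?mulr0 ?cos0 ?mul1r//;
    exact: intg_cosmix.
have [d d0 gd] := cosT_near0 pg.1 g00.
rewrite (_ : cosT stable v = expR (- cosmix (tail z) 0) *
    cosT (fun x => expR (cosmix (tail z) x) * g x) v); last first.
  rewrite /cosT -RintegralZl//; last first.
    apply: intg_cos.
    exact: (posdef_expR (measurable_cosmix it t0) (fun x => cosmix_le x it t0)
      (fun f => posdef_cosmix it t0) pg).1.
  by apply: eq_Rintegral => x _; rewrite stableE; ring.
apply: mulr_gt0; first exact: expR_gt0.
apply: lt_le_trans (cosT_expR_ge (measurable_cosmix it t0)
  (fun x => cosmix_le x it t0) (fun f => posdef_cosmix it t0) pg v).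
have [iF ->] := cosT_cosmix v it pg.1.
pose b := ln (v + d / 2).
have vd : v < v + d / 2 by rewrite ltrDl divr_gt0.
have vd0 : 0 < v + d / 2 by rewrite (lt_trans v0).
apply: (@Rintegral_gt0 _ _ z b (k b * (2^-1 * (cosT g 0 / 2)))) => //.
- by rewrite ltr_ln.
- by rewrite !mulr_gt0 ?expR_gt0 ?invr_gt0.
- by move=> y; rewrite !mulr_ge0// addr_ge0// pg.2.
move=> y /andP[zy yb]; rewrite tailE zy mul1r ler_pM//.
- by rewrite !mulr_ge0// ltW.
- by rewrite /k ler_wpM2l// ler_expR lerN2 ler_wpM2l// ltW.
rewrite ler_wpM2l// -[leLHS]add0r lerD ?pg.2//; apply: gd.
have e1 : v <= expR y by rewrite -ez ler_expR.
have e2 : expR y <= v + d / 2 by rewrite -(lnK (_ : v + d / 2 \in Num.pos))// ler_expR.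
by rewrite ler0_norm ?subr_le0//; lra.
Qed.

End stable_density_gt0.

(** * The discrete Fokker-Planck operator *)

Section equilibrium_facts.
Context {R : realType}.
Implicit Types alpha h v : R.

Lemma muE alpha v : mu alpha v =
  (2 * pi)^-1 * cosT (fun x => expR (- (`|x| `^ alpha / alpha))) v.
Proof.
rewrite /mu /cmu /cintegral /= [X in _ - X]mul0r [LHS]subr0; congr (_ * _).
apply: eq_Rintegral => x _ /=.
by rewrite !mul0r !mul1r !subr0 !add0r mulrC.
Qed.

Lemma equilibrium_gt0 alpha h j : 0 < alpha < 2 -> 0 < equilibrium alpha h j.
Proof.
by move=> a02; rewrite /equilibrium muE mulr_gt0 ?stable_density_gt0// invr_gt0
  mulr_gt0// pi_gt0.
Qed.

Lemma equilibriumN alpha h j : equilibrium alpha h (- j) = equilibrium alpha h j.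
Proof. by rewrite /equilibrium !muE mulrNz mulNr cosTN. Qed.

End equilibrium_facts.

Section zsum_facts.
Context {R : realType}.
Implicit Types F G : int -> R.

Lemma eq_zsum (a b : int) F G : (forall j, a <= j <= b -> F j = G j) ->
  zsum a b F = zsum a b G.
Proof.
move=> FG; rewrite /zsum; case: ifPn => // ab; apply: eq_bigr => i _.
by apply: FG; move: (nat_of_ord i) (ltn_ord i) => p; lia.
Qed.

Lemma zsumN (a b : int) F : zsum (- b) (- a) F = zsum a b (fun j => F (- j)).
Proof.
rewrite /zsum lerN2; case: ifPn => // ab.
rewrite opprK [- a + b]addrC (reindex_inj rev_ord_inj)/=.
apply: eq_bigr => i _; congr F; move: (nat_of_ord i) (ltn_ord i) => m.
by lia.
Qed.

Lemma zsumD (a b : int) F G :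
  zsum a b (fun j => F j + G j) = zsum a b F + zsum a b G.
Proof. by rewrite /zsum; case: ifPn => _; rewrite ?addr0// big_split. Qed.

Lemma zsumZ (a b : int) (c : R) F :
  zsum a b (fun j => c * F j) = c * zsum a b F.
Proof. by rewrite /zsum; case: ifPn => _; rewrite ?mulr0// mulr_sumr. Qed.

Lemma zsum0 F : zsum 0 0 F = F 0.
Proof. by rewrite /zsum lexx subrr big_ord1 addr0. Qed.

Lemma zsum_symS (n : nat) F : zsum (- n.+1%:Z) n.+1%:Z F =
  F (- n.+1%:Z) + zsum (- n%:Z) n%:Z F + F n.+1%:Z.
Proof.
rewrite /zsum !ifT; [|by lia..].
have -> : `|n.+1%:Z - - n.+1%:Z|%N = (`|n%:Z - - n%:Z|%N).+2 by lia.
rewrite big_ord_recl big_ord_recr/= addr0 addrA.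
congr (_ + _ + _).
- apply: eq_bigr => i _; congr F; rewrite /bump leq0n.
  by move: (nat_of_ord i) => p; lia.
- by congr F; rewrite /bump leq0n; lia.
Qed.

Lemma zsum_telescope (n : nat) G :
  zsum (- n%:Z) n%:Z (fun j => G j - G (j - 1)) = G n%:Z - G (- n%:Z - 1).
Proof.
elim: n => [|n IH]; first by rewrite zsum0.
rewrite zsum_symS IH (_ : n.+1%:Z - 1 = n%:Z); last by lia.
rewrite (_ : - n.+1%:Z = - n%:Z - 1); last by lia.
by ring.
Qed.

End zsum_facts.

Section central_symmetry.
Context {R : realType} (alpha h gamma beta0 : R) (J K : nat).

Lemma zidx_rev (i : 'I_(J.*2.+1)) : zidx (rev_ord i) = - zidx i.
Proof. by rewrite /zidx /=; move: (nat_of_ord i) (ltn_ord i) => p; lia. Qed.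

Lemma zidx_bound (i : 'I_(J.*2.+1)) : (absz (zidx i) <= J)%N.
Proof. by rewrite /zidx; move: (nat_of_ord i) (ltn_ord i) => p; lia. Qed.

Lemma entryE (f : 'cV[R]_(J.*2.+1)) (j : int) (i : 'I_(J.*2.+1)) :
  zidx i = j -> entry f j = f i ord0.
Proof. by move=> <-; exact: entry_zidx. Qed.

Lemma entry_equilibrium (j : int) : (absz j <= J)%N ->
  entry (equilibrium_vec alpha h J) j = equilibrium alpha h j.
Proof. by move=> jJ; rewrite /entry mxE zidx_inord. Qed.

Lemma beta_even (k : int) :
  beta alpha h beta0 K (- k) = beta alpha h beta0 K k.
Proof. by rewrite /beta abszN. Qed.

Lemma P_entry_boundary (j : int) : (0 < J)%N ->
  P_entry alpha h gamma beta0 J K (- j) (- J%:Z) =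
  P_entry alpha h gamma beta0 J K j J%:Z.
Proof.
move=> J0; rewrite /P_entry abszN absz_nat ltnn eqxx.
rewrite (_ : (- J%:Z == J%:Z) = false); last by apply/negbTE; lia.
congr (_ * _); rewrite -opprD zsumN; apply: eq_zsum => l /andP[Jl _].
rewrite normrN ger0_norm; last by lia.
by congr (_ * _); rewrite -[RHS]beta_even; congr beta; lia.
Qed.

Lemma P_entryN (j k : int) : (0 < J)%N -> (absz k <= J)%N ->
  P_entry alpha h gamma beta0 J K (- j) (- k) =
  P_entry alpha h gamma beta0 J K j k.
Proof.
move=> J0 kJ; have [kltJ|] := ltnP (absz k) J.
  by rewrite /P_entry abszN kltJ -opprD beta_even.
move=> Jk; have [->|->] : k = J%:Z \/ k = - J%:Z by lia.
  exact: P_entry_boundary.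
by rewrite opprK -[in RHS](opprK j) P_entry_boundary.
Qed.

Lemma Q_entryN (j k : int) : (0 < J)%N -> (absz k <= J)%N ->
  Q_entry alpha h gamma J K (- j) (- k) = Q_entry alpha h gamma J K j k.
Proof.
move=> J0 kJ; rewrite /Q_entry abszN; case: ltnP => // Jk.
have [->|->] : k = J%:Z \/ k = - J%:Z by lia.
  rewrite eqxx (_ : (- J%:Z == J%:Z) = false); last by apply/negbTE; lia.
  by rewrite mulrNz mulNr.
rewrite opprK eqxx (_ : (- J%:Z == J%:Z) = false); last by apply/negbTE; lia.
by rewrite mulrNz mulNr opprK.
Qed.

Lemma Lambda_rev (i k : 'I_(J.*2.+1)) : (0 < J)%N ->
  Lambda alpha h gamma beta0 J K (rev_ord i) (rev_ord k) =
  Lambda alpha h gamma beta0 J K i k.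
Proof.
move=> J0; rewrite !mxE !zidx_rev (inj_eq rev_ord_inj).
by rewrite P_entryN ?Q_entryN// zidx_bound.
Qed.

Lemma entry_LambdaM_even (j : int) : (0 < J)%N -> (absz j <= J)%N ->
  let LM := Lambda alpha h gamma beta0 J K *m equilibrium_vec alpha h J in
  entry LM (- j) = entry LM j.
Proof.
move=> J0 jJ LM; pose i : 'I_(J.*2.+1) := inord (absz (j + J%:Z)).
have ij : zidx i = j by rewrite zidx_inord.
have rij : zidx (rev_ord i) = - j by rewrite zidx_rev ij.
rewrite (entryE LM ij) (entryE LM rij).
rewrite !mxE (reindex_inj rev_ord_inj)/=; apply: eq_bigr => k _.
by rewrite Lambda_rev// !mxE zidx_rev equilibriumN.
Qed.

End central_symmetry.

Section fluxes.
Context {R : realType} (alpha h gamma beta0 : R) (J K : nat).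

Local Notation M := (equilibrium_vec alpha h J).
Local Notation LM := (Lambda alpha h gamma beta0 J K *m M).
Local Notation I := (tail_param alpha h J).
Local Notation V n :=
  (- 2^-1 * zsum (- Posz n) (Posz n) (fun k => entry LM k * h)).

Lemma VM_nat (n : nat) : VM alpha h gamma beta0 J K n%:Z = V n.
Proof. by []. Qed.

Lemma VM_opp (n : nat) : VM alpha h gamma beta0 J K (- n.+1%:Z) = - V n.
Proof.
rewrite /VM; cbv zeta; rewrite (_ : (0 <= - n.+1%:Z) = false); last by lia.
by rewrite (_ : - - n.+1%:Z - 1 = n%:Z)//; lia.
Qed.

Lemma V_step (n : nat) : (n < J)%N -> V n.+1 - V n = - (h * entry LM n.+1%:Z).
Proof.
move=> nJ; have J0 : (0 < J)%N by exact: leq_ltn_trans nJ.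
by rewrite zsum_symS entry_LambdaM_even//; field.
Qed.

Lemma A_flux_equilibrium (j : int) : 0 < alpha < 2 -> - J%:Z <= j < J%:Z ->
  A_flux alpha h gamma beta0 K M j = VM alpha h gamma beta0 J K j.
Proof.
move=> a02 jJ; rewrite /A_flux !entry_equilibrium; [|lia..].
by rewrite !divff ?gt_eqF ?equilibrium_gt0//; field.
Qed.

Lemma drift_interior (f : 'cV[R]_(J.*2.+1)) (j : int) : (absz j < J)%N ->
  entry (drift alpha h gamma beta0 K f) j =
  h^-1 * (A_flux alpha h gamma beta0 K f j - A_flux alpha h gamma beta0 K f (j - 1)).
Proof.
move=> jJ; rewrite /entry mxE; cbv zeta.
by rewrite zidx_inord ?(ltnW jJ)// jJ.
Qed.

Lemma drift_right (f : 'cV[R]_(J.*2.+1)) :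
  entry (drift alpha h gamma beta0 K f) J%:Z =
  h^-1 * (F_right alpha h gamma beta0 K f - A_flux alpha h gamma beta0 K f (J%:Z - 1)).
Proof. by rewrite /entry mxE; cbv zeta; rewrite zidx_inord ?absz_nat// ltnn eqxx. Qed.

Lemma drift_left (f : 'cV[R]_(J.*2.+1)) : (0 < J)%N ->
  entry (drift alpha h gamma beta0 K f) (- J%:Z) =
  h^-1 * (A_flux alpha h gamma beta0 K f (- J%:Z) - F_left alpha h gamma beta0 K f).
Proof.
move=> J0; rewrite /entry mxE; cbv zeta; rewrite zidx_inord ?abszN ?absz_nat// ltnn.
by rewrite (_ : (- J%:Z == J%:Z) = false)//; apply/negbTE; lia.
Qed.

Lemma entryD (f g : 'cV[R]_(J.*2.+1)) j : entry (f + g) j = entry f j + entry g j.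
Proof. by rewrite /entry mxE. Qed.

Lemma fokker_planck_equilibrium (j : int) :
  0 < alpha < 2 -> 0 < h -> (0 < J)%N -> h + I != 0 -> - J%:Z <= j <= J%:Z ->
  entry (fokker_planck alpha h gamma beta0 K M) j = 0.
Proof.
move=> a02 h0 J0 hI jJ; rewrite /fokker_planck entryD.
have hn0 : h != 0 by rewrite gt_eqF.
have [m Jm] : exists m, J = m.+1 by exists J.-1; rewrite prednK.
have inner : zsum (- J%:Z + 1) (J%:Z - 1) (fun k => entry LM k * h) =
    zsum (- m%:Z) m%:Z (fun k => entry LM k * h).
  by congr zsum; rewrite Jm; lia.
have AR : A_flux alpha h gamma beta0 K M (J%:Z - 1) = V m.
  rewrite A_flux_equilibrium//; last by lia.
  by rewrite (_ : J%:Z - 1 = m%:Z) ?Jm//; lia.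
have AL : A_flux alpha h gamma beta0 K M (- J%:Z) = - V m.
  rewrite A_flux_equilibrium//; last by lia.
  by rewrite [in LHS]Jm -VM_opp -Jm.
have [jltJ|Jj] := ltnP (absz j) J; last first.
  have [->|->] : j = J%:Z \/ j = - J%:Z by lia.
    rewrite drift_right /F_right AR inner; field.
    by rewrite hI hn0.
  rewrite drift_left// /F_left AL inner; field.
  by rewrite hI hn0.
rewrite drift_interior// !A_flux_equilibrium; [|lia..].
suff -> : VM alpha h gamma beta0 J K j - VM alpha h gamma beta0 J K (j - 1) =
    - (h * entry LM j) by rewrite mulrN mulKf// addNr.
have [n [jn|jn]] : exists n : nat, j = n%:Z \/ j = - n.+1%:Z.
  by exists (if 0 <= j then absz j else (absz j).-1); case: ifP; lia.
- case: n jn => [|n] jn; rewrite jn.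
    by rewrite (_ : 0%:Z - 1 = - 1%:Z)// VM_opp VM_nat zsum0; field.
  rewrite (_ : n.+1%:Z - 1 = n%:Z); last by lia.
  by rewrite !VM_nat V_step//; lia.
- rewrite jn (_ : - n.+1%:Z - 1 = - n.+2%:Z); last by lia.
  rewrite !VM_opp opprK addrC V_step; last by lia.
  by rewrite entry_LambdaM_even//; lia.
Qed.

Lemma fokker_planck_mass (f : 'cV[R]_(J.*2.+1)) :
  0 < h -> (0 < J)%N -> h + I != 0 ->
  zsum (- J%:Z) J%:Z (fun j => entry (fokker_planck alpha h gamma beta0 K f) j * h)
  + I * (entry (fokker_planck alpha h gamma beta0 K f) J%:Z
         + entry (fokker_planck alpha h gamma beta0 K f) (- J%:Z)) = 0.
Proof.
move=> h0 J0 hI; have hn0 : h != 0 by rewrite gt_eqF.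
have [m Jm] : exists m, J = m.+1 by exists J.-1; rewrite prednK.
set Lf := Lambda alpha h gamma beta0 J K *m f.
set A := A_flux alpha h gamma beta0 K f.
have inner : zsum (- J%:Z + 1) (J%:Z - 1) (fun k => entry Lf k * h) =
    zsum (- m%:Z) m%:Z (fun k => entry Lf k * h).
  by congr zsum; rewrite Jm; lia.
have splitJ F : zsum (- J%:Z) J%:Z F =
    F (- J%:Z) + zsum (- m%:Z) m%:Z F + F J%:Z :> R.
  by rewrite [in LHS]Jm zsum_symS -Jm.
have driftm : zsum (- m%:Z) m%:Z
    (fun j => entry (fokker_planck alpha h gamma beta0 K f) j * h) =
    A (J%:Z - 1) - A (- J%:Z) + zsum (- m%:Z) m%:Z (fun k => entry Lf k * h).
  rewrite (_ : A (J%:Z - 1) - A (- J%:Z) = A m%:Z - A (- m%:Z - 1)); last first.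
    by congr (A _ - A _); rewrite Jm; lia.
  rewrite -zsum_telescope -zsumD; apply: eq_zsum => j jm.
  rewrite entryD drift_interior; last by lia.
  by rewrite -/A -/Lf; field.
rewrite splitJ driftm !entryD drift_right drift_left// /F_right /F_left.
rewrite -/A -/Lf inner; field.
by rewrite hI hn0.
Qed.

End fluxes.

Theorem proposition3p2 (R : realType) (alpha h gamma beta0 : R) (J K : nat)
    (halpha : 0 < alpha < 2) (hh : 0 < h) (hgamma : 0 < gamma)
    (hJ : (1 <= J)%N) (hK : (2 * J <= K)%N) (hKodd : odd K)
    (hI : h + tail_param alpha h J != 0) :
  (forall j : int, - J%:Z <= j <= J%:Z ->
     entry (fokker_planck alpha h gamma beta0 K (equilibrium_vec alpha h J)) j
     = 0)
  /\
  (forall (dt : R) (f0 f1 : 'cV[R]_(J.*2.+1)),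
     0 < dt ->
     dt^-1 *: (f1 - f0) = fokker_planck alpha h gamma beta0 K f1 ->
     zsum (- J%:Z) J%:Z (fun j => entry f1 j * h)
       + tail_param alpha h J * (entry f1 J%:Z + entry f1 (- J%:Z))
     = zsum (- J%:Z) J%:Z (fun j => entry f0 j * h)
       + tail_param alpha h J * (entry f0 J%:Z + entry f0 (- J%:Z))).
Proof.
split=> [j jJ|dt f0 f1 dt0 scheme]; first exact: fokker_planck_equilibrium.
have f1E j : entry f1 j =
    entry f0 j + dt * entry (fokker_planck alpha h gamma beta0 K f1) j.
  by rewrite -scheme /entry !mxE; field; rewrite gt_eqF.
have mass0 := fokker_planck_mass gamma beta0 K f1 hh hJ hI.
rewrite !f1E (_ : zsum _ _ (fun j => entry f1 j * h) =
    zsum (- J%:Z) J%:Z (fun j => entry f0 j * h) + dt * zsum (- J%:Z) J%:Z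
      (fun j => entry (fokker_planck alpha h gamma beta0 K f1) j * h)).
  by rewrite -[RHS]addr0 -(mulr0 dt) -mass0; ring.
by rewrite -zsumZ -zsumD; apply: eq_zsum => j _; rewrite f1E; ring.
Qed.
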